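(* A Nash equilibrium $q^a$ of the voltage control game $\mathcal G=\{\mathcal N,(\Omega_i)_{i\in\mathcal N},(h_i)_{i\in\mathcal N}\}$ is a fixed point (equilibrium) of the signal-anticipating voltage control $$q_i(t+1)=\arg\min_{q_i\in\Omega_i}\ C_i(q_i)+q_i\Big(X_{ii}q_i+\sum_{j\in\mathcal N\setminus\{i\}}X_{ij}q_j(t)+\Delta\tilde v_i\Big),\qquad i\in\mathcal N,$$ and vice versa.
   Context: Network: a rooted tree with node set $\mathcal N\cup\{0\}$, $\mathcal N=\{1,\dots,n\}$, root $0$, and set of lines (edges) $\mathcal L$; each line $(h,k)\in\mathcal L$ has reactance $x_{hk}>0$. $\mathcal L_i\subseteq\mathcal L$ is the set of lines on the unique path from $0$ to $i$. The reactance matrix $X\in\mathbb R^{n\times n}$ is $X_{ij}=\sum_{(h,k)\in\mathcal L_i\cap\mathcal L_j}x_{hk}$; it is symmetric positive definite. $\Delta\tilde v\in\mathbb R^n$ is a given constant vector. For each $i\in\mathcal N$: $\delta_i\ge 0$; $f_i:\mathbb R\to\mathbb R$ is a control function with $f_i(u)=0$ for $u\in[-\delta_i/2,\delta_i/2]$, nonincreasing over $\mathbb R$, strictly decreasing and differentiable on $(-\infty,-\delta_i/2)\cup(\delta_i/2,\infty)$; $\Omega_i=\{q_i: q_i^{\min}\le q_i\le q_i^{\max}\}$ is a nonempty closed interval; $\Omega=\times_{i\in\mathcal N}\Omega_i$. The cost function of node $i$ is $C_i(q_i)=-\int_0^{q_i}f_i^{-1}(q)\,dq$, where $f_i^{-1}$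 is the inverse of $f_i$ (the value assigned at $q=0$ is immaterial; it is implicit that $f_i^{-1}$ is defined at all nonzero points between $0$ and points of $\Omega_i$, so that $C_i$ is well defined on $\Omega_i$). Voltage control game $\mathcal G$: the players are the nodes $i\in\mathcal N$, the strategy space of $i$ is $\Omega_i$, and the cost function of $i$ is $h_i(q)=C_i(q_i)+q_i\big(\sum_{j\in\mathcal N}X_{ij}q_j+\Delta\tilde v_i\big)$, also written $h_i(q_i,q_{-i})$. A vector $q^a\in\Omega$ is a Nash equilibrium if for all $i\in\mathcal N$, $h_i(q_i^a,q_{-i}^a)\le h_i(q_i,q_{-i}^a)$ for all $q_i\in\Omega_i$. *)

(* Defs.v *)
From mathcomp Require Import all_boot all_order all_algebra.
From mathcomp Require Import all_classical all_reals all_analysis.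

Set Implicit Arguments.
Unset Strict Implicit.
Unset Printing Implicit Defensive.

Import Order.TTheory GRing.Theory Num.Theory.
Import numFieldNormedType.Exports.

Local Open Scope classical_set_scope.
Local Open Scope ring_scope.

(* The vertices are 'I_n.+1 with root ord0; the node indexed by i : 'I_n is the
   vertex lift ord0 i. A line is stored as one ordered pair (h, k), in an
   arbitrary orientation. *)
Section Network.
Variables (n : nat) (L : {set 'I_n.+1 * 'I_n.+1}).
Implicit Types (h k : 'I_n.+1) (p : seq 'I_n.+1) (i j : 'I_n).

Definition adj : rel 'I_n.+1 :=
  fun h k => ((h, k) \in L) || ((k, h) \in L).

(* [:: p_1; ...; p_m] with h, p_1, ..., p_m = k distinct, consecutively adjacent *)
Definition simple_path h k p : Prop :=
  [/\ path adj h p, last h p = k & uniq (h :: p)].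

(* The first clause forbids loops and listing a line in both orientations. *)
Definition tree : Prop :=
  (forall h k, (h, k) \in L -> (k, h) \notin L) /\
  (forall h k, exists! p, simple_path h k p).

Definition root_path i : seq 'I_n.+1 :=
  xget [::] [set p | simple_path ord0 (lift ord0 i) p].

Definition lines_to i : {set 'I_n.+1 * 'I_n.+1} :=
  let steps := zip (ord0 :: root_path i) (root_path i) in
  [set l in L | (l \in steps) || ((l.2, l.1) \in steps)]%SET.

Definition reactance_mx (R : realType) (x : 'I_n.+1 -> 'I_n.+1 -> R) :
    'M[R]_n :=
  \matrix_(i, j) \sum_(l in lines_to i :&: lines_to j) x l.1 l.2.

End Network.

Section Control.
Variable R : realType.
Implicit Types (f g : R -> R) (a b d q : R).

Definition outside_deadband d : set R := [set u | u < - (d / 2) \/ d / 2 < u].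

Definition control_function d f : Prop :=
  [/\ forall u, - (d / 2) <= u <= d / 2 -> f u = 0,
      {homo f : u v / u <= v >-> v <= u},
      {in outside_deadband d &, {homo f : u v / u < v >-> v < u}} &
      {in outside_deadband d, forall u, derivable f u 1}].

(* A preimage under f (unique at nonzero points of the range of a control
   function), and 0 outside the range. *)
Definition inv_fun f q : R := xget 0 [set u | f u = q].

Definition oriented_integral a b g : R :=
  if a <= b then Rintegral lebesgue_measure `[a, b] g
  else - Rintegral lebesgue_measure `[b, a] g.

Definition node_cost f q : R := - oriented_integral 0 q (inv_fun f).

(* The inverse is defined at every nonzero point between 0 and a point of D. *)
Definition inv_defined_to (D : set R) f : Prop :=
  forall q p, D q -> (0 < p <= q) || (q <= p < 0) -> exists u, f u = p.

Definition argmin (D : set R) (phi : R -> R) : set R :=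
  [set y | D y /\ forall z, D z -> phi y <= phi z].

End Control.

Section Game.
Variables (R : realType) (n : nat).
Implicit Types (Omega : 'I_n -> set R) (q : 'cV[R]_n).

(* (y, q_{-i}) *)
Definition deviate q (i : 'I_n) (y : R) : 'cV[R]_n :=
  \col_j (if j == i then y else q j 0).

Definition nash_equilibrium Omega (h : 'I_n -> 'cV[R]_n -> R) q : Prop :=
  (forall i, Omega i (q i 0)) /\
  (forall i y, Omega i y -> h i q <= h i (deviate q i y)).

Definition game_cost (f : 'I_n -> R -> R) (X : 'M[R]_n) (dv : 'cV[R]_n)
    (i : 'I_n) q : R :=
  node_cost (f i) (q i 0) + q i 0 * (\sum_j X i j * q j 0 + dv i 0).

(* q' is the state following q: for each i the set of minimizers is exactly
   the singleton {q'_i}, i.e. q'_i is the (unique) argmin. *)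
Definition anticipating_step Omega (f : 'I_n -> R -> R) (X : 'M[R]_n)
    (dv : 'cV[R]_n) (q q' : 'cV[R]_n) : Prop :=
  forall i, argmin (Omega i) (fun y => node_cost (f i) y +
    y * (X i i * y + \sum_(j | j != i) X i j * q j 0 + dv i 0)) = [set q' i 0].

Definition anticipating_fixed_point Omega (f : 'I_n -> R -> R) (X : 'M[R]_n)
    (dv : 'cV[R]_n) q : Prop :=
  anticipating_step Omega f X dv q q.

End Game.

(* Main.v *)
Require Import Defs.
From mathcomp Require Import all_boot all_order all_algebra.
From mathcomp Require Import all_classical all_reals all_analysis.
From mathcomp Require Import measurable_realfun ring lra.

(** The cost that node [i] minimizes in the anticipating control is, as a
    function of its own strategy, its cost in the game: the self term
    [X i i * y] is already the deviated term of the sum over all nodes. Hence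
    a profile is a Nash equilibrium exactly when each [q i 0] is a minimizer,
    over the strategy interval, of

      phi y = node_cost (f i) y + y * (X i i * y + c),

    with [c] independent of [y]. A fixed point of the control asks for more,
    namely that [q i 0] be the only minimizer, so the content of the theorem is
    that [phi] has at most one minimizer. This follows from strict convexity,
    which has two sources.

    - The quadratic coefficient [X i i] is positive: it is the sum of the
      reactances along the path from the root to node [i], and this path has at
      least one line ([reactance_mx_diag_gt0]).
    - The control cost is convex. A nonincreasing [f i] has an inverse that is
      nonincreasing on the range of [f i] ([inv_fun_nonincreasing]), whatever
      preimages are selected; and minus a primitive of a nonincreasing function
      [g] has [- g y] as a subgradient at [y] ([oriented_integral_subgradient]).
      The range of [f i] contains the interval spanned by [0] and the strategy
      set, so the inequality is available at all strategies.

    Adding the two subgradient inequalities at the midpoint of two strategies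
    gives strict midpoint convexity of [phi] ([anticipating_cost_midpoint]), and
    two distinct minimizers would be beaten by their midpoint
    ([argmin_unique]). *)

Set Implicit Arguments.
Unset Strict Implicit.
Unset Printing Implicit Defensive.

Import Order.TTheory GRing.Theory Num.Theory.
Import numFieldNormedType.Exports.

Local Open Scope classical_set_scope.
Local Open Scope ring_scope.

(** * Primitives of nonincreasing functions *)

(** Off [[a, b]] nothing is known of [g]; clamping the argument to [[a, b]]
    gives a globally nonincreasing, hence measurable, function that agrees with
    [g] there, and [g] is bounded by its values at the end points. *)
Lemma nonincreasing_integrable (R : realType) (a b : R) (g : R -> R) :
  {in `[a, b] &, {homo g : x y / x <= y >-> y <= x}} ->
  lebesgue_measure.-integrable `[a, b] (EFin \o g).
Proof.
move=> g_dec; have [ab|ba] := leP a b; last first.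
  by rewrite set_itv_ge -?leNgt ?bnd_simp -?ltNge//; exact: integrable_set0.
pose clamp x : R := Num.max a (Num.min x b).
have clampP x : clamp x \in `[a, b].
  by rewrite in_itv/= /clamp le_max lexx/= ge_max ab/= ge_min lexx orbT.
apply: measurable_bounded_integrable => //.
- by rewrite /= lebesgue_measure_itv/=; case: ifP => // _; rewrite -EFinB ltry.
- apply: (eq_measurable_fun (g \o clamp)) => [x|].
    rewrite inE/= in_itv/= => /andP[ax xb].
    by rewrite /clamp (min_idPl xb) (max_idPr ax).
  apply: nonincreasing_measurable => // x y xy /=.
  by apply: g_dec => //; rewrite /clamp le_max2 ?le_min2.
- have aab : a \in `[a, b] by rewrite in_itv/= lexx ab.
  have bab : b \in `[a, b] by rewrite in_itv/= lexx ab.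
  pose M := `|g a| + `|g b|.
  exists M; split; rewrite ?num_real// => N MN x /= xab.
  have /andP[ax xb] : a <= x <= b by move: xab; rewrite in_itv.
  have gxa : g x <= g a by exact: g_dec.
  have gbx : g b <= g x by exact: g_dec.
  apply/ltW/(le_lt_trans _ MN); rewrite /M ler_norml.
  have := ler_norm (g a); have := ler_norm (- g b); rewrite normrN.
  have := normr_ge0 (g a); have := normr_ge0 (g b).
  by move=> *; apply/andP; split; lra.
Qed.

Section NonincreasingIntegral.
Variables (R : realType) (a b : R) (g : R -> R).
Hypothesis g_dec : {in `[a, b] &, {homo g : x y / x <= y >-> y <= x}}.
Notation mu := (@lebesgue_measure R).

Lemma nonincreasing_integrableS y z : a <= y -> z <= b ->
  mu.-integrable `[y, z] (EFin \o g).
Proof.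
move=> ay zb; apply: integrableS (nonincreasing_integrable g_dec) => //.
by apply: subset_itv; rewrite bnd_simp.
Qed.

Lemma nonincreasing_Rintegral_bounds y z : a <= y -> y <= z -> z <= b ->
  g z * (z - y) <= Rintegral mu `[y, z] g <= g y * (z - y).
Proof.
move=> ay yz zb.
have mu_yz : fine (mu `[y, z]) = z - y.
  rewrite /= lebesgue_measure_itv/= lte_fin.
  by case: ltgtP yz => // -> _; rewrite subrr.
have cst_int (r : R) : mu.-integrable `[y, z] (EFin \o cst r).
  by apply: nonincreasing_integrable => u v _ _ _ /=.
have g_int := nonincreasing_integrableS ay zb.
have in_ab t : t \in `[y, z] -> t \in `[a, b].
  rewrite !in_itv/= => /andP[yt tz].
  by rewrite (le_trans ay yt) (le_trans tz zb).
have yyz : y \in `[y, z] by rewrite in_itv/= lexx yz.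
have zyz : z \in `[y, z] by rewrite in_itv/= lexx yz.
rewrite -mu_yz -!(Rintegral_cst mu)//; apply/andP; split.
- apply: le_Rintegral => //; first exact: cst_int.
  move=> t tyz; apply: g_dec; rewrite ?in_ab//.
  by move: tyz; rewrite /= in_itv => /andP[].
- apply: le_Rintegral => //; first exact: cst_int.
  move=> t tyz; apply: g_dec; rewrite ?in_ab//.
  by move: tyz; rewrite /= in_itv => /andP[].
Qed.

Lemma Rintegral_itv_split x y z : a <= x -> x <= y -> y <= z -> z <= b ->
  Rintegral mu `[x, z] g = Rintegral mu `[x, y] g + Rintegral mu `[y, z] g.
Proof.
move=> ax xy yz zb; have xz_int := nonincreasing_integrableS ax zb.
rewrite -[X in _ = _ + X]Rintegral_itv_obnd_cbnd; last first.
  by apply: integrableS xz_int => //; apply: subset_itv; rewrite bnd_simp.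
by rewrite -(Rintegral_itvB xz_int) ?bnd_simp// addrC subrK.
Qed.

Hypothesis ab0 : a <= 0 <= b.

Lemma oriented_integralB y z : a <= y -> y <= z -> z <= b ->
  oriented_integral 0 z g - oriented_integral 0 y g = Rintegral mu `[y, z] g.
Proof.
move: ab0 => /andP[a0 b0] ay yz zb; rewrite /oriented_integral.
case: (leP 0 y) => [y0|/ltW y0].
  rewrite (le_trans y0 yz) (@Rintegral_itv_split 0 y z)//.
  by rewrite addrAC subrr add0r.
case: (leP 0 z) => [z0|/ltW z0].
  by rewrite (@Rintegral_itv_split y 0 z)// opprK addrC.
rewrite (@Rintegral_itv_split y z 0)// opprK; lra.
Qed.

(** Between [y] and [z] the integrand is at most [g y] when [y <= z] and at
    least [g y] otherwise; in both cases the increment of the primitive lies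
    below the tangent line at [y]. *)
Lemma oriented_integral_subgradient y z : y \in `[a, b] -> z \in `[a, b] ->
  oriented_integral 0 z g - oriented_integral 0 y g <= g y * (z - y).
Proof.
rewrite !in_itv/= => /andP[ay yb] /andP[az zb].
have [yz|/ltW zy] := leP y z.
  rewrite oriented_integralB//.
  by have /andP[] := nonincreasing_Rintegral_bounds ay yz zb.
rewrite -opprB oriented_integralB// -(opprB y z) mulrN lerN2.
by have /andP[] := nonincreasing_Rintegral_bounds az zy yb.
Qed.

End NonincreasingIntegral.

(** * Convexity of the control cost *)

Section ControlCost.
Variables (R : realType) (f : R -> R).
Hypothesis f_dec : {homo f : u v / u <= v >-> v <= u}.

Lemma inv_funK (p : R) : (exists u, f u = p) -> f (inv_fun f p) = p.
Proof. by move=> /(@xgetPex _ 0 [set u | f u = p]). Qed.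

(** If [p < r] but [inv_fun f p < inv_fun f r], applying [f] reverses the second
    inequality into [r <= p]. *)
Lemma inv_fun_nonincreasing (p r : R) :
  (exists u, f u = p) -> (exists u, f u = r) ->
  p <= r -> inv_fun f r <= inv_fun f p.
Proof.
move=> fp fr; rewrite le_eqVlt => /predU1P[->//|pr].
rewrite leNgt; apply/negP => /ltW/f_dec.
by rewrite !inv_funK// leNgt pr.
Qed.

Variables (lo hi : R).
Hypothesis f_zero : exists u, f u = 0.
Hypothesis f_inv : inv_defined_to `[lo, hi] f.

(** The integral defining the cost starts at [0], which need not be a strategy;
    the interval on which [inv_fun f] has to be monotone is the one spanned by
    [0] and the strategies. *)
Lemma inv_fun_nonincreasing_hull : lo <= hi ->
  {in `[Num.min 0 lo, Num.max 0 hi] &,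
    {homo inv_fun f : p r / p <= r >-> r <= p}}.
Proof.
move=> lohi.
have in_range p : p \in `[Num.min 0 lo, Num.max 0 hi] -> exists u, f u = p.
  rewrite in_itv/= ge_min le_max => /andP[lo_p p_hi].
  case: (ltgtP p 0) => [p0|p0|->//].
  - apply: (f_inv (q := lo)); first by rewrite /= in_itv/= lexx lohi.
    by rewrite p0 andbT; move: lo_p; rewrite (leNgt 0) p0 /= => ->; rewrite orbT.
  - apply: (f_inv (q := hi)); first by rewrite /= in_itv/= lohi lexx.
    by rewrite p0/=; move: p_hi; rewrite (leNgt p) p0 /= => ->.
by move=> p r /in_range fp /in_range fr; exact: inv_fun_nonincreasing.
Qed.

Lemma node_cost_subgradient y z : y \in `[lo, hi] -> z \in `[lo, hi] ->
  node_cost f y - inv_fun f y * (z - y) <= node_cost f z.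
Proof.
move=> y_in z_in.
have lohi : lo <= hi.
  by move: y_in; rewrite in_itv => /andP[]; exact: le_trans.
have hull : {subset `[lo, hi] <= `[Num.min 0 lo, Num.max 0 hi]}.
  by apply: subitvP; rewrite subitvE !bnd_simp ge_min lexx orbT le_max lexx orbT.
have zero_in : Num.min 0 lo <= 0 <= Num.max 0 hi.
  by rewrite ge_min le_max lexx.
have := oriented_integral_subgradient (inv_fun_nonincreasing_hull lohi)
  zero_in (hull _ y_in) (hull _ z_in).
by rewrite /node_cost; lra.
Qed.

Lemma anticipating_cost_midpoint (k c y z : R) :
  let phi t := node_cost f t + t * (k * t + c) in
  0 < k -> y != z -> y \in `[lo, hi] -> z \in `[lo, hi] ->
  2 * phi ((y + z) / 2) < phi y + phi z.
Proof.
move=> phi k0 yz y_in z_in; rewrite /phi.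
set m := (y + z) / 2.
have m_in : m \in `[lo, hi].
  by move: y_in z_in; rewrite !in_itv/= /m => /andP[? ?] /andP[? ?]; lra.
have Cy := node_cost_subgradient m_in y_in.
have Cz := node_cost_subgradient m_in z_in.
(* The slopes at the midpoint cancel; the quadratic part leaves this square. *)
have sq_gt0 : 0 < k * (y - z) ^+ 2.
  by rewrite mulr_gt0// exprn_even_gt0//= subr_eq0.
have quad : y * (k * y + c) + z * (k * z + c) - 2 * (m * (k * m + c)) =
  k * (y - z) ^+ 2 / 2 by rewrite /m; field.
have slope : inv_fun f m * (y - m) + inv_fun f m * (z - m) = 0.
  by rewrite /m; field.
lra.
Qed.

End ControlCost.

(** Two distinct minimizers would both exceed the value at their midpoint. *)
Lemma argmin_unique (R : realType) (D : set R) (phi : R -> R) :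
  (forall y z, D y -> D z -> D ((y + z) / 2)) ->
  (forall y z, y != z -> D y -> D z -> 2 * phi ((y + z) / 2) < phi y + phi z) ->
  forall y z, argmin D phi y -> argmin D phi z -> y = z.
Proof.
move=> Dmid phi_mid y z [Dy y_min] [Dz z_min]; apply/eqP; apply: contraT => yz.
have Dm := Dmid _ _ Dy Dz.
have := phi_mid _ _ yz Dy Dz; have := y_min _ Dm; have := z_min _ Dm.
lra.
Qed.

(** * The network and the game *)

(** Distinct vertices are joined by a nonempty path, and the first step of the
    path from the root to node [i] is a line counted in [X i i]. *)
Lemma reactance_mx_diag_gt0 (R : realType) (n : nat)
    (L : {set 'I_n.+1 * 'I_n.+1}) (x : 'I_n.+1 -> 'I_n.+1 -> R) :
  tree L -> (forall h k, (h, k) \in L -> 0 < x h k) ->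
  forall i, 0 < reactance_mx L x i i.
Proof.
move=> [_ L_path] x_gt0 i; rewrite mxE finset.setIid.
have lines_in l : l \in lines_to L i -> l \in L.
  by rewrite inE => /andP[].
have x_pos l : l \in lines_to L i -> 0 < x l.1 l.2.
  by move=> /lines_in; case: l => h k; exact: x_gt0.
suff [l li] : exists l, l \in lines_to L i.
  rewrite (bigD1 l)//= ltr_wpDr ?x_pos// sumr_ge0// => j /andP[ji _].
  exact/ltW/x_pos.
have [p [p_path _]] := L_path ord0 (lift ord0 i).
have : simple_path L ord0 (lift ord0 i) (root_path L i).
  by apply: (@xgetPex _ [::] [set p | simple_path L ord0 (lift ord0 i) p]); exists p.
rewrite /lines_to /=; case: (root_path L i) => [|k s] [].
  by move=> _ /= /eqP; rewrite (negPf (neq_lift _ _)).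
move=> /= /andP[+ _] _ _ => /orP[kL|kL].
- by exists (ord0, k); rewrite inE kL/= in_cons eqxx.
- by exists (k, ord0); rewrite inE kL/= [X in _ || X]in_cons eqxx orbT.
Qed.

Lemma game_cost_deviate (R : realType) (n : nat) (f : 'I_n -> R -> R)
    (X : 'M[R]_n) (dv q : 'cV[R]_n) i y :
  game_cost f X dv i (deviate q i y) =
  node_cost (f i) y +
    y * (X i i * y + \sum_(j | j != i) X i j * q j 0 + dv i 0).
Proof.
rewrite /game_cost mxE eqxx (bigD1 i)//= mxE eqxx.
congr (_ + _ * (_ + _ + _)); apply: eq_bigr => j ji.
by rewrite mxE (negPf ji).
Qed.

Lemma deviate_id (R : realType) (n : nat) (q : 'cV[R]_n) i :
  deviate q i (q i 0) = q.
Proof. by apply/colP => j; rewrite mxE; case: eqP => // ->. Qed.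

Lemma nash_equilibrium_argmin (R : realType) (n : nat) (Omega : 'I_n -> set R)
    (f : 'I_n -> R -> R) (X : 'M[R]_n) (dv q : 'cV[R]_n) :
  nash_equilibrium Omega (game_cost f X dv) q <->
  forall i, argmin (Omega i) (fun y => node_cost (f i) y +
    y * (X i i * y + \sum_(j | j != i) X i j * q j 0 + dv i 0)) (q i 0).
Proof.
split=> [[q_in q_min] i|q_argmin].
  split=> // y y_in; have := q_min i y y_in.
  by rewrite -{1}(deviate_id q i) !game_cost_deviate.
split=> [i|i y y_in]; first by have [] := q_argmin i.
have [_ q_min] := q_argmin i.
by rewrite -{1}(deviate_id q i) !game_cost_deviate; exact: q_min.
Qed.

Theorem lemma1 (R : realType) (n : nat)
    (L : {set 'I_n.+1 * 'I_n.+1}) (x : 'I_n.+1 -> 'I_n.+1 -> R)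
    (dv : 'cV[R]_n) (delta : 'I_n -> R) (f : 'I_n -> R -> R)
    (qmin qmax : 'I_n -> R)
    (L_tree : tree L)
    (x_gt0 : forall h k : 'I_n.+1, (h, k) \in L -> 0 < x h k)
    (delta_ge0 : forall i, 0 <= delta i)
    (f_control : forall i, control_function (delta i) (f i))
    (Omega_neq0 : forall i, qmin i <= qmax i)
    (f_inv : forall i, inv_defined_to `[qmin i, qmax i]%classic (f i))
    (q : 'cV[R]_n) :
  let X := reactance_mx L x in
  let Omega := fun i => `[qmin i, qmax i]%classic in
  nash_equilibrium Omega (game_cost f X dv) q <->
  anticipating_fixed_point Omega f X dv q.
Proof.
move=> X Omega; rewrite nash_equilibrium_argmin; split=> q_argmin i; last first.
  by have /seteqP[_] := q_argmin i; exact.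
apply/seteqP; split=> [y y_argmin|_ ->] /=; last exact: q_argmin.
have [f_dead f_dec _ _] := f_control i.
have f_zero : exists u, f i u = 0.
  by exists 0; apply: f_dead; have := delta_ge0 i; lra.
apply: argmin_unique y_argmin (q_argmin i).
- by move=> u v; rewrite /Omega /= !in_itv/= => /andP[? ?] /andP[? ?]; lra.
- move=> u v uv u_in v_in.
  have := anticipating_cost_midpoint f_dec f_zero (f_inv i)
    (\sum_(j | j != i) X i j * q j 0 + dv i 0)
    (reactance_mx_diag_gt0 L_tree x_gt0 i) uv u_in v_in.
  by rewrite /= !addrA.
Qed.
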